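(* Let $U\subseteq\mathbb{R}^4$ be open, with the Euclidean metric $dx^2$. A conformally flat metric $\widetilde g=\lambda^2dx^2$ on $U$ (with $\lambda:U\to\mathbb{R}$ smooth and positive) is biharmonic with respect to $dx^2$ if and only if the conformal factor $\lambda$ is a solution of the Yamabe equation or, equivalently, the Riemannian manifold $(U,\widetilde g=\lambda^2dx^2)$ has constant scalar curvature $R$ and $\Delta\lambda=-\frac{R}{6}\lambda^3$.
   Context: $\Delta=\mathrm{div}\,\mathrm{grad}$ is the Euclidean Laplacian (negative spectrum). For a smooth map $\phi:(M,g)\to(N,h)$ between Riemannian manifolds, the tension field is $\tau(\phi)=\mathrm{Tr}_g\nabla d\phi$. The map $\phi$ is biharmonic if $$-\mathrm{Tr}_g(\nabla^\phi)^2\tau(\phi)-\mathrm{Tr}_g R^N(\tau(\phi),d\phi)d\phi=0,$$ where $\nabla^\phi$ is the pull-back connection on $\phi^{-1}TN$ and $R^N$ is the Riemannian curvature of $N$ with the convention $R(X,Y)Z=\nabla_X\nabla_YZ-\nabla_Y\nabla_XZ-\nabla_{[X,Y]}Z$. A metric $\widetilde g$ on $(M,g)$ is called biharmonic with respect to $g$ if the identity map $(M,g)\to(M,\widetilde g)$ is biharmonic. The Yamabe equation on an $n$-dimensional $(M^n,g)$, $n\ge3$, with scalar curvature $R_g$ is $-\frac{4(n-1)}{n-2}\Delta u+R_gu=Ru^{(n+2)/(n-2)}$ with $R$ constant; for $n=4$ and $g=dx^2$ Euclidean it reduces to $\Delta u=-\frac{R}{6}u^3$, where $R$ is the constant scalar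 curvature of the metric $u^2dx^2$.
   Formalization: For disconnected U a single constant R can fail (different constants on different components), so the claim is proved with constant R for connected U, and with R locally constant (constant on each component) for every open U. *)

(* Defs.v *)
From HB Require Import structures.
From mathcomp Require Import all_boot all_order all_algebra.
From mathcomp Require Import all_classical all_reals all_analysis.

Set Implicit Arguments.
Unset Strict Implicit.
Unset Printing Implicit Defensive.

Import Order.TTheory GRing.Theory Num.Theory.
Import numFieldNormedType.Exports.

Local Open Scope classical_set_scope.
Local Open Scope ring_scope.

(* Riemannian geometry of open subsets of R^n in the standard global
   coordinates.  Points and tangent vectors are row vectors, a vector field is
   a map 'rV_n -> 'rV_n, and a metric is the map sending a point to its Gram
   matrix.  All objects are total functions; only their values on the open set
   under consideration matter, since every operator below is local. *)

Section Coordinates.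
Context {R : realType} {n : nat}.

Definition evec (i : 'I_n) : 'rV[R]_n := delta_mx 0 i.

Definition pderiv (i : 'I_n) (f : 'rV[R]_n -> R) : 'rV[R]_n -> R :=
  fun x => 'D_(evec i) f x.

(* C^infinity on U: the iterated partial derivatives of all orders exist on U
   and are differentiable (hence continuous) there. *)
Definition smooth_on (U : set 'rV[R]_n) (f : 'rV[R]_n -> R) : Prop :=
  forall (s : seq 'I_n) (x : 'rV[R]_n), U x ->
    differentiable (foldr pderiv f s) x.

Definition locally_constant_on (U : set 'rV[R]_n) (f : 'rV[R]_n -> R) : Prop :=
  forall x, U x -> \forall y \near x, f y = f x.

Definition metric := 'rV[R]_n -> 'M[R]_n.

Definition euclidean : metric := fun=> 1%:M.

Definition conformal (lambda : 'rV[R]_n -> R) (g : metric) : metric :=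
  fun x => lambda x ^+ 2 *: g x.

(* The coefficients g^{ij} *)
Definition ginv (g : metric) (x : 'rV[R]_n) : 'M[R]_n := invmx (g x).

(* Gamma^k_{ij} *)
Definition christoffel (g : metric) (k i j : 'I_n) (x : 'rV[R]_n) : R :=
  2^-1 * \sum_l ginv g x k l *
    (pderiv i (fun y => g y j l) x + pderiv j (fun y => g y i l) x
     - pderiv l (fun y => g y i j) x).

(* Levi-Civita connection: \nabla_X Y *)
Definition nabla (g : metric) (X Y : 'rV[R]_n -> 'rV[R]_n) :
    'rV[R]_n -> 'rV[R]_n :=
  fun x => 'D_(X x) Y x +
    \row_k \sum_i \sum_j christoffel g k i j x * X x 0 i * Y x 0 j.

Definition lie_bracket (X Y : 'rV[R]_n -> 'rV[R]_n) : 'rV[R]_n -> 'rV[R]_n :=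
  fun x => 'D_(X x) Y x - 'D_(Y x) X x.

Definition curvature (g : metric) (X Y Z : 'rV[R]_n -> 'rV[R]_n) :
    'rV[R]_n -> 'rV[R]_n :=
  fun x => nabla g X (nabla g Y Z) x - nabla g Y (nabla g X Z) x
           - nabla g (lie_bracket X Y) Z x.

(* The curvature is tensorial, so its value on tangent vectors at p may be
   computed by extending them to constant-coefficient vector fields. *)
Definition curvature_at (g : metric) (p u v w : 'rV[R]_n) : 'rV[R]_n :=
  curvature g (cst u) (cst v) (cst w) p.

(* Ric(v, w) = Tr (u |-> R(u, v) w) *)
Definition ricci (g : metric) (p v w : 'rV[R]_n) : R :=
  \sum_i curvature_at g p (evec i) v w 0 i.

Definition scalar_curvature (g : metric) (p : 'rV[R]_n) : R :=
  \sum_i \sum_j ginv g p i j * ricci g p (evec i) (evec j).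

Definition grad (g : metric) (f : 'rV[R]_n -> R) : 'rV[R]_n -> 'rV[R]_n :=
  fun x => \row_k \sum_j ginv g x k j * pderiv j f x.

(* div X = Tr (\nabla X) *)
Definition divergence (g : metric) (X : 'rV[R]_n -> 'rV[R]_n) (x : 'rV[R]_n) :
    R :=
  \sum_i nabla g (cst (evec i)) X x 0 i.

Definition laplacian (g : metric) (f : 'rV[R]_n -> R) : 'rV[R]_n -> R :=
  divergence g (grad g f).

(* The Yamabe equation on U with right-hand side S u^{(n+2)/(n-2)}; it is
   meaningful for n >= 3 and u > 0. *)
Definition yamabe_eq (U : set 'rV[R]_n) (g : metric) (S u : 'rV[R]_n -> R) :
    Prop :=
  forall x, U x ->
    - (4 * (n%:R - 1) / (n%:R - 2)) * laplacian g u x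
      + scalar_curvature g x * u x
    = S x * (u x `^ ((n%:R + 2) / (n%:R - 2))).

Definition yamabe_solution (U : set 'rV[R]_n) (g : metric)
    (u : 'rV[R]_n -> R) : Prop :=
  exists c : R, yamabe_eq U g (cst c) u.

End Coordinates.

Arguments metric : clear implicits.

Section Maps.
Context {R : realType} {m n : nat}.
Implicit Types (g : metric R m) (h : metric R n) (phi : 'rV[R]_m -> 'rV[R]_n).

(* d phi (X), a vector field along phi *)
Definition dmap phi (X : 'rV[R]_m -> 'rV[R]_m) : 'rV[R]_m -> 'rV[R]_n :=
  fun x => 'D_(X x) phi x.

(* Pull-back connection \nabla^phi_X V on phi^{-1}TN *)
Definition pullback_nabla h phi (X : 'rV[R]_m -> 'rV[R]_m)
    (V : 'rV[R]_m -> 'rV[R]_n) : 'rV[R]_m -> 'rV[R]_n :=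
  fun x => 'D_(X x) V x +
    \row_k \sum_i \sum_j
      christoffel h k i j (phi x) * dmap phi X x 0 i * V x 0 j.

(* (\nabla d phi)(X, Y) *)
Definition second_fundamental_form g h phi (X Y : 'rV[R]_m -> 'rV[R]_m) :
    'rV[R]_m -> 'rV[R]_n :=
  fun x => pullback_nabla h phi X (dmap phi Y) x - dmap phi (nabla g X Y) x.

(* ((\nabla^phi)^2 V)(X, Y) *)
Definition pullback_nabla2 g h phi (V : 'rV[R]_m -> 'rV[R]_n)
    (X Y : 'rV[R]_m -> 'rV[R]_m) : 'rV[R]_m -> 'rV[R]_n :=
  fun x => pullback_nabla h phi X (pullback_nabla h phi Y V) x
           - pullback_nabla h phi (nabla g X Y) V x.

Definition tension g h phi : 'rV[R]_m -> 'rV[R]_n :=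
  fun x => \sum_i \sum_j ginv g x i j *:
    second_fundamental_form g h phi (cst (evec i)) (cst (evec j)) x.

Definition bitension g h phi : 'rV[R]_m -> 'rV[R]_n :=
  fun x =>
    - (\sum_i \sum_j ginv g x i j *:
        pullback_nabla2 g h phi (tension g h phi)
          (cst (evec i)) (cst (evec j)) x)
    - \sum_i \sum_j ginv g x i j *:
        curvature_at h (phi x) (tension g h phi x)
          (dmap phi (cst (evec i)) x) (dmap phi (cst (evec j)) x).

Definition biharmonic_map (U : set 'rV[R]_m) g h phi : Prop :=
  forall x, U x -> bitension g h phi x = 0.

End Maps.

(* The metric h is biharmonic with respect to g on U. *)
Definition biharmonic_metric {R : realType} {n : nat} (U : set 'rV[R]_n)
    (g h : metric R n) : Prop :=
  biharmonic_map U g h id.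

(* Main.v *)
(* Put sigma_i = d_i (log lambda), h_ij = d_i sigma_j (a symmetric matrix) and
   q = lambda^-3 * Delta lambda = lambda^-2 * (tr h + |sigma|^2).
   The Christoffel symbols of lambda^2 dx^2 are
     Gamma^k_ij = delta_jk sigma_i + delta_ik sigma_j - delta_ij sigma_k,
   so the identity map has tension field (2 - n) sigma, and for n = 4 expanding
   the connection and curvature terms of the bitension field gives
     bitension_k = 2 lambda^2 * d_k q.
   Hence biharmonicity says exactly that q is locally constant, while the scalar
   curvature of lambda^2 dx^2 is -6 q, which turns the condition on q into the
   Yamabe equation. *)
Require Import Defs.
From mathcomp Require Import all_boot all_order all_algebra.
From mathcomp Require Import all_classical all_reals all_analysis.
From mathcomp Require Import ring.
Set Implicit Arguments.
Unset Strict Implicit.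
Unset Printing Implicit Defensive.
Import Order.TTheory GRing.Theory Num.Theory.
Import numFieldNormedType.Exports.
Local Open Scope classical_set_scope.
Local Open Scope ring_scope.

(** * Smooth functions on an open set: derivative rules and closure properties *)

Section SmoothFunctions.
Context {R : realType} {n : nat}.
Implicit Types (U : set 'rV[R]_n) (f g : 'rV[R]_n -> R) (i : 'I_n).

Lemma near_eq_on {T : Type} U (F G : 'rV[R]_n -> T) x :
  open U -> (forall y, U y -> F y = G y) -> U x -> \near x, F x = G x.
Proof. by move=> oU FG Ux; apply: filterS FG (open_nbhs_nbhs (conj oU Ux)). Qed.

Lemma eq_on_pderiv U f g i : open U -> (forall x, U x -> f x = g x) ->
  forall x, U x -> pderiv i f x = pderiv i g x.
Proof. by move=> oU fg x Ux; apply: near_eq_derive; apply: near_eq_on Ux. Qed.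

(** The first-order expansion of [F] at [x] depends only on the germ of [F], so it also expands [G];
    uniqueness of the differential then gives ['d G x = 'd F x]. *)
Lemma near_eq_differentiable {V W : normedModType R} (F G : V -> W) x :
  (\near x, F x = G x) -> differentiable F x -> differentiable G x.
Proof.
move=> FG /diff_locallyP[cF eF]; have FGx := nbhs_singleton FG.
have eG : G \o shift x = cst (G x) + 'd F x +o_ 0 id.
  apply/eqaddoP => _/posnumP[e].
  move/eqaddoP : eF => /(_ e%:num) /(_ [gt0 of e%:num]).
  move: FG; rewrite {1}(near_shift 0 x) subr0.
  apply: filterS2 => h /= FGh.
  by rewrite !fctE /= FGx FGh.
have dG := diff_unique cF eG.
by apply/diff_locallyP; rewrite dG.
Qed.

Lemma pderiv_cst i (c : R) : pderiv i (fun=> c) = fun=> 0.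
Proof. by apply/funext => x; rewrite /pderiv derive_cst. Qed.

Lemma smooth_on_cst U (c : R) : smooth_on U (fun=> c).
Proof.
move=> s x _; have [d ds] : exists d : R, foldr pderiv (fun=> c) s = (fun=> d).
  elim: s => [|i s [d ds]]; first by exists c.
  by exists 0; rewrite /= ds; exact: pderiv_cst.
by rewrite ds; exact: differentiable_cst.
Qed.

Lemma smooth_on_differentiable U f x :
  smooth_on U f -> U x -> differentiable f x.
Proof. by move=> sf Ux; exact: (sf [::] x Ux). Qed.

(** In [foldr pderiv f s] the last index of [s] is differentiated first, so prior differentiation in
    direction [i] amounts to appending [i] at the end. *)
Lemma smooth_on_pderiv U f i : smooth_on U f -> smooth_on U (pderiv i f).
Proof.
by move=> sf s x Ux; have := sf (rcons s i) x Ux; rewrite foldr_rcons.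
Qed.

Lemma smooth_on_derivable U f x v :
  smooth_on U f -> U x -> derivable f x v.
Proof. by move=> sf Ux; apply/diff_derivable/(smooth_on_differentiable sf). Qed.

Lemma pderivD U f g i x : smooth_on U f -> smooth_on U g -> U x ->
  pderiv i (fun y => f y + g y) x = pderiv i f x + pderiv i g x.
Proof.
move=> sf sg Ux.
by apply: (@deriveD _ _ _ f g); exact: smooth_on_derivable Ux.
Qed.

Lemma pderivM U f g i x : smooth_on U f -> smooth_on U g -> U x ->
  pderiv i (fun y => f y * g y) x = pderiv i f x * g x + f x * pderiv i g x.
Proof.
move=> sf sg Ux; rewrite addrC [_ * g x]mulrC.
by apply: (@deriveM _ _ f g); exact: smooth_on_derivable Ux.
Qed.

Lemma pderivV U f i x : smooth_on U f -> U x -> f x != 0 ->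
  pderiv i (fun y => (f y)^-1) x = - (pderiv i f x * ((f x)^-1 * (f x)^-1)).
Proof.
move=> sf Ux fx0; rewrite /pderiv deriveV//; last exact: smooth_on_derivable Ux.
by rewrite /GRing.scale/= expr2 invfM mulNr mulrC.
Qed.

(* The rational expressions in smooth functions form a class that is closed
   under partial derivatives, up to equality on U; smoothness follows. *)
Inductive smooth_expr U : ('rV[R]_n -> R) -> Prop :=
| smooth_base f of smooth_on U f : smooth_expr U f
| smooth_add f g of smooth_expr U f & smooth_expr U g :
    smooth_expr U (fun x => f x + g x)
| smooth_mul f g of smooth_expr U f & smooth_expr U g :
    smooth_expr U (fun x => f x * g x)
| smooth_inv f of smooth_expr U f & (forall x, U x -> f x != 0) :
    smooth_expr U (fun x => (f x)^-1).

Lemma smooth_expr_differentiable U f x :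
  smooth_expr U f -> U x -> differentiable f x.
Proof.
move=> + Ux; elim=> {f} [f sf|f g _ df _ dg|f g _ df _ dg|f _ df f0].
- exact: smooth_on_differentiable sf Ux.
- exact: differentiableD.
- exact: differentiableM.
- by apply: differentiableV => //; exact: f0.
Qed.

Lemma smooth_expr_pderiv U f i : smooth_expr U f ->
  exists2 g, smooth_expr U g & forall x, U x -> pderiv i f x = g x.
Proof.
elim=> {f} [f sf|f g ef [f' ef' ff'] eg [g' eg' gg']
  |f g ef [f' ef' ff'] eg [g' eg' gg']|f ef [f' ef' ff'] f0].
- by exists (pderiv i f) => //; apply: smooth_base; exact: smooth_on_pderiv.
- exists (fun x => f' x + g' x); first exact: smooth_add.
  move=> x Ux; rewrite -ff'// -gg'//; apply: (@deriveD _ _ _ f g);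
    apply: diff_derivable;
  exact: smooth_expr_differentiable Ux.
- exists (fun x => f' x * g x + f x * g' x).
    by apply: smooth_add; exact: smooth_mul.
  move=> x Ux; rewrite -ff'// -gg'// addrC [_ * g x]mulrC.
  by apply: (@deriveM _ _ f g); apply: diff_derivable;
    exact: smooth_expr_differentiable Ux.
(* Expressions have no constructor for opposites; the sign is a product with the constant -1. *)
- exists (fun x => (- 1) * (f' x * ((f x)^-1 * (f x)^-1))).
    do !apply: smooth_mul => //; try exact: smooth_inv.
    exact/smooth_base/smooth_on_cst.
  move=> x Ux; rewrite -ff'// mulN1r /pderiv deriveV//.
  + by rewrite /GRing.scale/= expr2 invfM mulNr mulrC.
  + exact: f0.
  + exact/diff_derivable/(smooth_expr_differentiable ef).
Qed.

Lemma smooth_expr_smooth U f : open U -> smooth_expr U f -> smooth_on U f.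
Proof.
move=> oU ef s x Ux.
(* An iterated derivative equals an expression only on [U]; since [U] is open, this is enough both
   to differentiate again and to transfer differentiability. *)
suff [g eg fg] : exists2 g, smooth_expr U g &
    forall y, U y -> foldr pderiv f s y = g y.
  apply: (@near_eq_differentiable _ _ g).
    by apply: near_eq_on Ux => // y Uy; rewrite fg.
  exact: smooth_expr_differentiable eg Ux.
elim: s => [|i s [g eg fg]] /=; first by exists f.
have [g' eg' gg'] := smooth_expr_pderiv i eg.
by exists g' => // y Uy; rewrite (eq_on_pderiv i oU fg)// gg'.
Qed.

Lemma smooth_onD U f g : open U -> smooth_on U f -> smooth_on U g ->
  smooth_on U (fun x => f x + g x).
Proof.
move=> oU sf sg; apply: smooth_expr_smooth => //.
by apply: smooth_add; exact: smooth_base.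
Qed.

Lemma smooth_onM U f g : open U -> smooth_on U f -> smooth_on U g ->
  smooth_on U (fun x => f x * g x).
Proof.
move=> oU sf sg; apply: smooth_expr_smooth => //.
by apply: smooth_mul; exact: smooth_base.
Qed.

Lemma smooth_onV U f : open U -> smooth_on U f ->
  (forall x, U x -> f x != 0) -> smooth_on U (fun x => (f x)^-1).
Proof.
move=> oU sf f0; apply: smooth_expr_smooth => //.
by apply: smooth_inv => //; exact: smooth_base.
Qed.

Lemma smooth_on_sum U m (F : 'I_m -> 'rV[R]_n -> R) : open U ->
  (forall j, smooth_on U (F j)) -> smooth_on U (fun x => \sum_j F j x).
Proof.
move=> oU; elim: m F => [|m IH] F sF.
  rewrite (_ : (fun x => _) = fun=> 0); first exact: smooth_on_cst.
  by apply/funext => x; rewrite big_ord0.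
rewrite (_ : (fun x => _) =
    fun x => F ord0 x + \sum_j F (lift ord0 j) x).
  by apply: smooth_onD => //; exact: IH.
by apply/funext => x; rewrite big_ord_recl.
Qed.

Lemma pderiv_sum U m (F : 'I_m -> 'rV[R]_n -> R) i x :
  (forall j, smooth_on U (F j)) -> U x ->
  pderiv i (fun y => \sum_j F j y) x = \sum_j pderiv i (F j) x.
Proof.
move=> sF Ux; rewrite /pderiv -derive_sum.
  by congr ('D__ _ x); apply/funext => y; rewrite fct_sumE.
by move=> j; exact: smooth_on_derivable Ux.
Qed.

Lemma derive_pderiv (f : 'rV[R]_n -> R) (x v : 'rV[R]_n) :
  differentiable f x -> 'D_v f x = \sum_i v 0 i * pderiv i f x.
Proof.
move=> df; rewrite deriveE// {1}(row_sum_delta v) linear_sum.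
by apply: eq_bigr => i _; rewrite linearZ/= -deriveE.
Qed.

End SmoothFunctions.

(** * Mean value theorem along lines and symmetry of second derivatives *)

Section MixedPartials.
Context {R : realType} {V : normedModType R}.
Implicit Types (f : V -> R) (x a v w : V).

Lemma is_derive_line f a v (t : R) : derivable f (a + t *: v) v ->
  is_derive t 1 (fun s => f (a + s *: v)) ('D_v f (a + t *: v)).
Proof.
move=> df.
(* The difference quotient of the restriction to the line is literally the directional quotient of
   [f]. *)
have E : (fun h : R => h^-1 *: (f (a + (h *: 1 + t) *: v) - f (a + t *: v))) =
         (fun h => h^-1 *: (f (h *: v + (a + t *: v)) - f (a + t *: v))).
  apply/funext => h; congr (_ *: (f _ - _)).
  by rewrite [_%:A]mulr1 scalerDl addrCA.
by apply: DeriveDef; rewrite /derivable /derive/= E.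
Qed.

Lemma MVT_line f a v (r : R) : 0 < r ->
  (forall t, 0 <= t <= r -> derivable f (a + t *: v) v) ->
  exists2 c, 0 <= c <= r &
    f (a + r *: v) - f a = r * 'D_v f (a + c *: v).
Proof.
move=> r0 df.
have dl t : 0 <= t <= r ->
    is_derive t 1 (fun s => f (a + s *: v)) ('D_v f (a + t *: v)).
  by move=> t0r; apply: is_derive_line; exact: df.
have [|||c] := @MVT _ (fun s => f (a + s *: v))
  (fun t => 'D_v f (a + t *: v)) 0 r => //.
- move=> t; rewrite in_itv/= => /andP[t0 tr]; apply: dl.
  by rewrite !ltW.
- apply: derivable_within_continuous => t; rewrite in_itv/= => t0r.
  by have := dl t t0r => -[].
- rewrite in_itv/= => /andP[c0 cr]; rewrite scale0r addr0 subr0 mulrC => fE.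
  by exists c => //; rewrite !ltW.
Qed.

(** The mean value theorem is applied twice: to [phi], the increment of [f] along [r *: w] as a
    function of the step along [v], and then to ['D_v f] along [w]. The left-hand side is symmetric
    in [v] and [w], which is what makes the mixed derivatives comparable. *)
Lemma second_difference f x v w (r : R) : 0 < r ->
  (forall s t, 0 <= s <= r -> 0 <= t <= r ->
     derivable f (x + s *: v + t *: w) v /\
     derivable ('D_v f) (x + s *: v + t *: w) w) ->
  exists s, exists2 t, (0 <= s <= r) && (0 <= t <= r) &
    f (x + r *: v + r *: w) - f (x + r *: v) - f (x + r *: w) + f x =
    r * (r * 'D_w ('D_v f) (x + s *: v + t *: w)).
Proof.
move=> r0 df.
have r0r : 0 <= r <= r by rewrite lexx ltW.
have z0r : (0:R) <= 0 <= r by rewrite lexx ltW.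
pose phi s := f (x + r *: w + s *: v) - f (x + s *: v).
pose dphi s := 'D_v f (x + r *: w + s *: v) - 'D_v f (x + s *: v).
have dl s : 0 <= s <= r -> is_derive s 1 phi (dphi s).
  move=> s0r; apply: is_deriveB; apply: is_derive_line.
    by rewrite addrAC; have [] := df s r s0r r0r.
  by have [] := df s 0 s0r z0r; rewrite scale0r addr0.
have [|||s] := @MVT _ phi dphi 0 r => //.
- move=> t; rewrite in_itv/= => /andP[t0 tr]; apply: dl.
  by rewrite !ltW.
- apply: derivable_within_continuous => t; rewrite in_itv/= => t0r.
  by have := dl t t0r => -[].
rewrite in_itv/= => /andP[s0 sr] phiE.
have s0r : 0 <= s <= r by rewrite !ltW.
have [|t t0r tE] := @MVT_line ('D_v f) (x + s *: v) w r r0.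
  by move=> t t0r; have [] := df s t s0r t0r.
exists s, t; first by rewrite s0r t0r.
rewrite -tE; move: phiE; rewrite /phi /dphi subr0 scale0r !addr0.
rewrite [_ * r]mulrC [x + r *: w + s *: v]addrAC [x + r *: w + r *: v]addrAC.
by move=> <-; rewrite opprD opprK addrA addrAC.
Qed.

(** The common value is taken at two points [p] and [q] that may differ, but both are close to [x],
    so it lies within [e / 2] of [A x] and of [B x]. *)
Lemma continuous_meet (A B : V -> R) x :
  {for x, continuous A} -> {for x, continuous B} ->
  (forall N, nbhs x N -> exists p q, [/\ N p, N q & A p = B q]) -> A x = B x.
Proof.
move=> cA cB AB; apply/eqP; rewrite -subr_eq0 -normr_le0.
apply/ler_addgt0Pr => e e0; rewrite add0r.
have e20 : 0 < e / 2 by rewrite divr_gt0.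
have nA : \forall y \near x, `|A x - A y| < e / 2.
  by move/cvgrPdist_lt : cA; exact.
have nB : \forall y \near x, `|B x - B y| < e / 2.
  by move/cvgrPdist_lt : cB; exact.
have [p [q [[Ap _] [_ Bq] pq]]] := AB _ (filterI nA nB).
rewrite (splitr e) -(subrKA (A p)) (le_trans (ler_normD _ _))// lerD//.
  exact: ltW.
by rewrite pq distrC ltW.
Qed.

(** Schwarz's theorem: on arbitrarily small parallelograms at [x] the same second difference is
    [r * r] times either mixed derivative at some point, and continuity identifies the two values at
    [x]. *)
Lemma derive_comm f x v w :
  (\near x, [/\ differentiable f x, differentiable ('D_v f) x
              & differentiable ('D_w f) x]) ->
  {for x, continuous ('D_w ('D_v f))} -> {for x, continuous ('D_v ('D_w f))} ->
  'D_w ('D_v f) x = 'D_v ('D_w f) x.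
Proof.
move=> df cA cB; apply: continuous_meet cA cB _ => N xN.
have /nbhs_ballP[d /= d0 dball] : \forall y \near x,
    [/\ differentiable f y, differentiable ('D_v f) y
      & differentiable ('D_w f) y] /\ N y.
  by apply: filterS2 df xN => y dy Ny; exact: conj dy Ny.
(* This size keeps the whole parallelogram inside the ball of radius [d]; the summand 1 makes the
   denominator positive even if [v] and [w] vanish, and the inclusion strict. *)
pose r := d / (`|v| + `|w| + 1).
have vw0 : 0 < `|v| + `|w| + 1 by rewrite ltr_wpDl// addr_ge0.
have r0 : 0 < r by rewrite divr_gt0.
have inb s t : 0 <= s <= r -> 0 <= t <= r -> ball x d (x + s *: v + t *: w).
  move=> /andP[s0 sr] /andP[t0 tr].
  rewrite -ball_normE/= -addrA opprD addNKr normrN.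
  apply: (@le_lt_trans _ _ (r * (`|v| + `|w|))).
    rewrite mulrDr (le_trans (ler_normD _ _))// !normrZ !ger0_norm//.
    by rewrite lerD// ler_wpM2r.
  by rewrite /r mulrAC ltr_pdivrMr// ltr_pM2l// ltrDl.
have inb' s t : 0 <= s <= r -> 0 <= t <= r -> ball x d (x + t *: w + s *: v).
  by rewrite addrAC; exact: inb.
have [|s [t /andP[s0r t0r] Ev]] := @second_difference f x v w r r0.
  move=> s t s0r t0r; have [[d1 d2 _] _] := dball _ (inb s t s0r t0r).
  by split; apply: diff_derivable; [exact: d1|exact: d2].
have [|t' [s' /andP[t'0r s'0r] Ew]] := @second_difference f x w v r r0.
  move=> t' s' t'0r s'0r; have [[d1 _ d3] _] := dball _ (inb' s' t' s'0r t'0r).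
  by split; apply: diff_derivable; [exact: d1|exact: d3].
exists (x + s *: v + t *: w), (x + t' *: w + s' *: v); split.
- by have [] := dball _ (inb s t s0r t0r).
- by have [] := dball _ (inb' s' t' s'0r t'0r).
apply: (mulfI (lt0r_neq0 r0)); apply: (mulfI (lt0r_neq0 r0)).
apply: etrans (esym Ev) _; apply: etrans _ Ew.
by rewrite [x + r *: w + r *: v]addrAC; congr (_ + _); exact: addrAC.
Qed.

End MixedPartials.

(** * Vanishing gradients and locally constant functions *)

Section LocallyConstant.
Context {R : realType} {n : nat}.
Implicit Types (U : set 'rV[R]_n) (f : 'rV[R]_n -> R) (i j : 'I_n).

Lemma pderivC U f i j x : open U -> smooth_on U f -> U x ->
  pderiv i (pderiv j f) x = pderiv j (pderiv i f) x.
Proof.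
move=> oU sf Ux; have sp k := smooth_on_pderiv k sf.
apply: derive_comm.
- apply: filterS (open_nbhs_nbhs (conj oU Ux)) => y Uy.
  by split; apply: smooth_on_differentiable Uy => //; exact: sp.
- apply: differentiable_continuous.
  by apply: smooth_on_differentiable Ux; do 2 apply: smooth_on_pderiv.
- apply: differentiable_continuous.
  by apply: smooth_on_differentiable Ux; do 2 apply: smooth_on_pderiv.
Qed.

(** A ball around [x] inside [U] is convex, so the mean value theorem applies on the segment from
    [x] to any of its points. *)
Lemma pderiv0_locally_constant U f : open U -> smooth_on U f ->
  (forall i x, U x -> pderiv i f x = 0) -> locally_constant_on U f.
Proof.
move=> oU sf f0 x Ux.
have /nbhs_ballP[d /= d0 dU] := open_nbhs_nbhs (conj oU Ux).
apply/nbhs_ballP; exists d => //= y xy.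
have seg c : 0 <= c <= 1 -> U (x + c *: (y - x)).
  move=> /andP[c0 c1]; apply: dU; move: xy.
  rewrite -!ball_normE/= opprD addNKr normrN normrZ ger0_norm// distrC.
  by apply: le_lt_trans; rewrite ler_piMl.
have [|c c01] := @MVT_line _ _ f x (y - x) 1 ltr01.
  by move=> t t01; apply: smooth_on_derivable sf _; exact: seg.
rewrite scale1r subrKC mul1r derive_pderiv; last first.
  by apply: smooth_on_differentiable sf _; exact: seg.
rewrite big1 => [/eqP|i _]; first by rewrite subr_eq0 => /eqP.
by rewrite f0 ?mulr0//; exact: seg.
Qed.

Lemma locally_constant_pderiv U f i x :
  locally_constant_on U f -> U x -> pderiv i f x = 0.
Proof.
move=> fc Ux.
rewrite /pderiv (@near_eq_derive _ _ _ f (fun=> f x)) ?derive_cst//.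
exact: fc.
Qed.

(** The level set of [f] through a point of [U] is open and closed in [U]. For empty [U] any
    constant will do. *)
Lemma locally_constant_connected U f : open U -> connected U ->
  locally_constant_on U f -> exists c, forall x, U x -> f x = c.
Proof.
move=> oU cU fc; have [[x0 Ux0]|U0] := pselect (U !=set0); last first.
  by exists 0 => x Ux; exfalso; apply: U0; exists x.
exists (f x0) => x Ux.
(* Every preimage under [f] is open; applied to a single value it shows the level set open, and
   applied to the complementary values it shows it relatively closed. *)
have opn (P : set R) : open (U `&` [set y | P (f y)]).
  rewrite openE => y [Uy Py]; apply: filterS2 (fc y Uy)
    (open_nbhs_nbhs (conj oU Uy)) => z fz Uz; split => //=.
  by rewrite fz.
suff UE : U `&` [set y | f y = f x0] = U.
  by move: Ux; rewrite -UE => -[].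
apply: cU.
- by exists x0.
- exists (U `&` [set y | f y = f x0]); last by rewrite setIA setIid.
  exact: (opn [set z | z = f x0]).
- exists (~` (U `&` [set y | f y <> f x0])).
    exact/open_closedC/(opn [set z | z <> f x0]).
  apply/seteqP; split => y /= [Uy].
    by move=> fy; split => // -[_].
  move=> fy; split => //; apply: contrapT => nfy; exact: fy.
Qed.

End LocallyConstant.

(** * The Euclidean metric, its traces and its flat connection *)

Section EuclideanMetric.
Context {R : realType} {n : nat}.
Implicit Types (u v w : 'rV[R]_n) (i j k : 'I_n).

Definition dot u v : R := \sum_i u 0 i * v 0 i.

Lemma sum_delta k (F : 'I_n -> R) : \sum_i F i * (i == k)%:R = F k.
Proof.
rewrite (bigD1 k)//= eqxx mulr1 big1 ?addr0// => i /negPf ->.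
by rewrite mulr0.
Qed.

Lemma sum_const_ord (a : R) : \sum_(i < n) a = n%:R * a.
Proof. by rewrite sumr_const card_ord mulr_natl. Qed.

Lemma evecE i j : (evec i : 'rV[R]_n) 0 j = (j == i)%:R.
Proof. by rewrite mxE eqxx. Qed.

Lemma evec_diag i : (evec i : 'rV[R]_n) 0 i = 1.
Proof. by rewrite evecE eqxx. Qed.

Lemma dot_evec u i : dot u (evec i) = u 0 i.
Proof. by rewrite -[RHS]sum_delta; apply: eq_bigr => j _; rewrite evecE. Qed.

Lemma dotr0 u : dot u 0 = 0.
Proof. by rewrite /dot big1// => i _; rewrite mxE mulr0. Qed.

Lemma dotC u v : dot u v = dot v u.
Proof. by apply: eq_bigr => i _; rewrite mulrC. Qed.

Lemma christoffel_euclidean k i j (x : 'rV[R]_n) :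
  christoffel euclidean k i j x = 0.
Proof.
by rewrite /christoffel big1 ?mulr0// => l _;
  rewrite !pderiv_cst !addr0 subr0 mulr0.
Qed.

Lemma nabla_euclidean X Y (x : 'rV[R]_n) : nabla euclidean X Y x = 'D_(X x) Y x.
Proof.
rewrite /nabla (_ : \row_k _ = 0) ?addr0//; apply/rowP => k; rewrite !mxE.
by rewrite big1// => i _; rewrite big1// => j _;
  rewrite christoffel_euclidean !mul0r.
Qed.

Lemma ginv_euclidean (x : 'rV[R]_n) i j : ginv euclidean x i j = (i == j)%:R.
Proof. by rewrite /ginv /euclidean invmx1 mxE. Qed.

Lemma trace_euclidean {V : lmodType R} (F : 'I_n -> 'I_n -> V) x :
  \sum_i \sum_j ginv euclidean x i j *: F i j = \sum_i F i i.
Proof.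
apply: eq_bigr => i _; rewrite (bigD1 i)//= ginv_euclidean eqxx scale1r.
by rewrite big1 ?addr0// => j; rewrite ginv_euclidean eq_sym => /negPf ->;
  rewrite scale0r.
Qed.

(** A connection is pointwise in [X] and local in [Y]. In iterated covariant derivatives this allows
    the inner one to be replaced by a closed formula valid only on [U]. *)
Lemma nabla_eq_on U (g : metric R n) X X' Y Y' x : open U -> U x ->
  X x = X' x -> (forall y, U y -> Y y = Y' y) ->
    nabla g X Y x = nabla g X' Y' x.
Proof.
move=> oU Ux XX' YY'.
have dYY' : 'D_(X' x) Y x = 'D_(X' x) Y' x.
  exact: near_eq_derive (near_eq_on oU YY' Ux).
by rewrite /nabla XX' dYY' (YY' x Ux).
Qed.

Lemma derive_row (Y : 'rV[R]_n -> 'rV[R]_n) (x v : 'rV[R]_n) k :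
  (forall j, differentiable (fun y => Y y 0 j) x) ->
  ('D_v Y x) 0 k = \sum_i v 0 i * pderiv i (fun y => Y y 0 k) x.
Proof.
move=> dY; rewrite derive_mx ?mxE; first by rewrite derive_pderiv.
by apply/derivable_mxP => i j; rewrite ord1; exact: diff_derivable.
Qed.

End EuclideanMetric.

(** * Curvature and bitension field for Christoffel symbols of conformally flat type *)

Section ConformalConnection.
Context {R : realType} {n : nat} (U : set 'rV[R]_n) (oU : open U).
(** The conformal factor itself is abstracted away: [s] stands for the gradient of [log lambda], [h]
    for its Hessian, and [g] enters through its Christoffel symbols on [U]. *)
Context (g : metric R n) (s : 'I_n -> 'rV[R]_n -> R)
  (h : 'I_n -> 'I_n -> 'rV[R]_n -> R).
Context (smooth_s : forall i, smooth_on U (s i))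
  (smooth_h : forall i j, smooth_on U (h i j))
  (pderiv_s : forall i j x, U x -> pderiv i (s j) x = h i j x)
  (hC : forall i j x, U x -> h i j x = h j i x)
  (christoffelE : forall k i j x, U x -> christoffel g k i j x =
    (j == k)%:R * s i x + (i == k)%:R * s j x - (i == j)%:R * s k x).
Implicit Types (u v w : 'rV[R]_n) (X Y : 'rV[R]_n -> 'rV[R]_n) (i j k : 'I_n).

Definition row_of (x : 'rV[R]_n) : 'rV[R]_n := \row_i s i x.

Definition hess_row u (x : 'rV[R]_n) : 'rV[R]_n :=
  \row_k \sum_i u 0 i * h i k x.

Definition hess_trace (x : 'rV[R]_n) : R := \sum_i h i i x.

Definition sqnorm (x : 'rV[R]_n) : R := dot (row_of x) (row_of x).

Lemma row_ofE x i : row_of x 0 i = s i x. Proof. by rewrite mxE. Qed.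

Lemma hess_row_evec i k x : hess_row (evec i) x 0 k = h i k x.
Proof.
rewrite mxE -[RHS](sum_delta i (fun j => h j k x)).
by apply: eq_bigr => j _; rewrite evecE mulrC.
Qed.

Lemma dot_hess_row u v x : U x -> dot (hess_row u x) v = dot (hess_row v x) u.
Proof.
move=> Ux; rewrite /dot.
under eq_bigr do rewrite mxE mulr_suml.
under [in RHS]eq_bigr do rewrite mxE mulr_suml.
rewrite exchange_big/=; apply: eq_bigr => i _; apply: eq_bigr => j _.
by rewrite (hC j i Ux); ring.
Qed.

(** Contracting the Kronecker deltas gives the index-free connection term
    [<s,v> w + <s,w> v - <v,w> s], on which the later computations rest. *)
Lemma connectionE k x v w : U x ->
  \sum_i \sum_j christoffel g k i j x * v 0 i * w 0 j =
  dot (row_of x) v * w 0 k + dot (row_of x) w * v 0 k - dot v w * s k x.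
Proof.
move=> Ux; rewrite (eq_bigr (fun i => row_of x 0 i * v 0 i * w 0 k +
    dot (row_of x) w * v 0 i * (i == k)%:R - v 0 i * w 0 i * s k x)).
  by rewrite sumrB big_split/= sum_delta -!mulr_suml.
move=> i _; rewrite (eq_bigr (fun j => s i x * v 0 i * w 0 j * (j == k)%:R +
    row_of x 0 j * w 0 j * ((i == k)%:R * v 0 i) -
    v 0 i * w 0 j * s k x * (j == i)%:R)).
  rewrite sumrB big_split/= !sum_delta -mulr_suml row_ofE -/(dot _ _).
  by ring.
move=> j _; rewrite (christoffelE k i j Ux) row_ofE [j == i]eq_sym.
by ring.
Qed.

Lemma nablaE X Y k x : U x -> (forall j, smooth_on U (fun y => Y y 0 j)) ->
  nabla g X Y x 0 k = \sum_i X x 0 i * pderiv i (fun y => Y y 0 k) x +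
    (dot (row_of x) (X x) * Y x 0 k + dot (row_of x) (Y x) * X x 0 k
     - dot (X x) (Y x) * s k x).
Proof.
move=> Ux sY; rewrite /nabla mxE derive_row.
  by rewrite mxE (connectionE k (X x) (Y x) Ux).
by move=> j; exact: smooth_on_differentiable (sY j) Ux.
Qed.

Lemma nabla_evecE i Y k x : U x -> (forall j, smooth_on U (fun y => Y y 0 j)) ->
  nabla g (cst (evec i)) Y x 0 k = pderiv i (fun y => Y y 0 k) x +
    (s i x * Y x 0 k + dot (row_of x) (Y x) * (k == i)%:R - Y x 0 i * s k x).
Proof.
move=> Ux sY; rewrite nablaE// /cst [dot (evec i) _]dotC !dot_evec evecE
  row_ofE.
congr (_ + _); rewrite -[RHS](sum_delta i (fun j => pderiv j _ x)).
by apply: eq_bigr => j _; rewrite evecE mulrC.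
Qed.

Lemma smooth_dot_row v : smooth_on U (fun y => dot (row_of y) v).
Proof.
apply: smooth_on_sum => // i; under eq_fun do rewrite row_ofE.
exact: smooth_onM (smooth_s i) (smooth_on_cst _).
Qed.

Lemma pderiv_dot_row i v x : U x ->
  pderiv i (fun y => dot (row_of y) v) x = dot (hess_row (evec i) x) v.
Proof.
move=> Ux; have sm j := smooth_onM oU (smooth_s j) (smooth_on_cst (v 0 j)).
rewrite (_ : (fun y => _) = fun y => \sum_j s j y * v 0 j).
  rewrite (pderiv_sum i sm Ux); apply: eq_bigr => j _.
  rewrite (pderivM i (smooth_s j) (smooth_on_cst (v 0 j)) Ux) pderiv_cst.
  by rewrite (pderiv_s i j Ux) hess_row_evec; ring.
by apply/funext => y; apply: eq_bigr => j _; rewrite row_ofE.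
Qed.

Lemma sum_dot_hess_row u v x :
  \sum_i u 0 i * dot (hess_row (evec i) x) v = dot (hess_row u x) v.
Proof.
rewrite /dot; under eq_bigr do rewrite mulr_sumr.
rewrite exchange_big/=; apply: eq_bigr => j _; rewrite [in RHS]mxE mulr_suml.
by apply: eq_bigr => i _; rewrite hess_row_evec mulrA.
Qed.

(** The last term carries its sign inside the constant factor, so that the field is a sum of
    products to which the sum and product rules apply directly. *)
Lemma nabla_cstE v w x : U x -> nabla g (cst v) (cst w) x =
  \row_k (dot (row_of x) v * w 0 k + (dot (row_of x) w * v 0 k
          + s k x * - dot v w)).
Proof.
move=> Ux; apply/rowP => k; rewrite nablaE// => [|j]; last exact: smooth_on_cst.
rewrite [RHS]mxE big1 ?add0r => [|i _]; first by rewrite /cst; ring.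
by rewrite pderiv_cst mulr0.
Qed.

Lemma smooth_nabla_cst v w k : smooth_on U (fun y =>
  dot (row_of y) v * w 0 k + (dot (row_of y) w * v 0 k + s k y * - dot v w)).
Proof.
have sc c : smooth_on U (fun=> c) by exact: smooth_on_cst.
apply: smooth_onD oU (smooth_onM oU (smooth_dot_row v) (sc _)) _.
apply: smooth_onD oU (smooth_onM oU (smooth_dot_row w) (sc _)) _.
exact: smooth_onM oU (smooth_s k) (sc _).
Qed.

Lemma pderiv_nabla_cst v w k i x : U x -> pderiv i (fun y =>
  dot (row_of y) v * w 0 k + (dot (row_of y) w * v 0 k + s k y * - dot v w)) x =
  dot (hess_row (evec i) x) v * w 0 k + (dot (hess_row (evec i) x) w * v 0 k
  + h i k x * - dot v w).
Proof.
move=> Ux; have sc c : smooth_on U (fun=> c) by exact: smooth_on_cst.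
have s1 := smooth_onM oU (smooth_dot_row v) (sc (w 0 k)).
have s2 := smooth_onM oU (smooth_dot_row w) (sc (v 0 k)).
have s3 := smooth_onM oU (smooth_s k) (sc (- dot v w)).
rewrite (pderivD i s1 (smooth_onD oU s2 s3) Ux) (pderivD i s2 s3 Ux).
rewrite (pderivM i (smooth_dot_row v) (sc _) Ux).
rewrite (pderivM i (smooth_dot_row w) (sc _) Ux).
rewrite (pderivM i (smooth_s k) (sc _) Ux) !pderiv_cst (pderiv_s i k Ux).
by rewrite (pderiv_dot_row i v Ux) (pderiv_dot_row i w Ux) !mulr0 !addr0.
Qed.

(** Differentiating the coefficients of the inner derivative yields the Hessian terms; the
    connection term of the outer one yields those quadratic in [s]. *)
Lemma nabla_nabla_cstE u v w k x : U x ->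
  nabla g (cst u) (nabla g (cst v) (cst w)) x 0 k =
  dot (hess_row u x) v * w 0 k + dot (hess_row u x) w * v 0 k
  - dot v w * hess_row u x 0 k + dot (row_of x) u *
    (dot (row_of x) v * w 0 k + dot (row_of x) w * v 0 k - dot v w * s k x) +
  (2 * dot (row_of x) v * dot (row_of x) w - dot v w * sqnorm x) * u 0 k -
  (dot (row_of x) v * dot u w + dot (row_of x) w * dot u v
   - dot v w * dot (row_of x) u) * s k x.
Proof.
move=> Ux; pose Y y : 'rV[R]_n := \row_j (dot (row_of y) v * w 0 j +
  (dot (row_of y) w * v 0 j + s j y * - dot v w)).
have YE j : (fun y => Y y 0 j) = fun y => dot (row_of y) v * w 0 j +
    (dot (row_of y) w * v 0 j + s j y * - dot v w).
  by apply/funext => y; rewrite mxE.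
rewrite (@nabla_eq_on _ _ U g (cst u) (cst u) _ Y x oU Ux erefl
  (nabla_cstE v w)).
rewrite nablaE// => [|j]; last by rewrite YE; exact: smooth_nabla_cst.
(* Needed for [a = row_of x] and for [a = u], the two scalar products with [Y] in the outer
   connection term. *)
have dE a : dot a (Y x) = dot (row_of x) v * dot a w +
    dot (row_of x) w * dot a v - dot v w * dot (row_of x) a.
  rewrite [dot a w]/dot [dot a v]/dot [dot _ a]/dot !mulr_sumr -big_split/=.
  rewrite -sumrB; apply: eq_bigr => i _; rewrite mxE row_ofE.
  by ring.
rewrite /cst !dE YE -/(sqnorm x) [Y x 0 k]mxE.
under eq_bigr => i _ do rewrite (pderiv_nabla_cst v w k i Ux) 2!mulrDr !mulrA.
rewrite !big_split/= -!mulr_suml !sum_dot_hess_row.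
have -> : \sum_i u 0 i * h i k x = hess_row u x 0 k by rewrite mxE.
by ring.
Qed.

(** Constant fields have zero bracket, so the curvature is the part of the second derivative
    antisymmetric in [u] and [v]; the term [Hess(u,v) w] cancels because the Hessian is
    symmetric. *)
Lemma curvature_atE u v w k x : U x -> curvature_at g x u v w 0 k =
  dot (hess_row u x) w * v 0 k - dot (hess_row v x) w * u 0 k
  - dot v w * hess_row u x 0 k + dot u w * hess_row v x 0 k
  - dot (row_of x) u * dot (row_of x) w * v 0 k
  + dot (row_of x) v * dot (row_of x) w * u 0 k
  - sqnorm x * dot v w * u 0 k + sqnorm x * dot u w * v 0 k
  + (dot v w * dot (row_of x) u - dot u w * dot (row_of x) v) * s k x.
Proof.
move=> Ux; rewrite /curvature_at /curvature.
have -> : nabla g (lie_bracket (cst u) (cst v)) (cst w) x = 0.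
  apply/rowP => j; rewrite nablaE// => [|i]; last exact: smooth_on_cst.
  have -> : lie_bracket (cst u) (cst v) x = 0.
    by rewrite /lie_bracket !derive_cst subrr.
  rewrite big1 => [|i _]; last by rewrite mxE mul0r.
  by rewrite [dot 0 _]dotC !dotr0 !mxE; ring.
have rowB (a b : 'rV[R]_n) : (a - b) 0 k = a 0 k - b 0 k by rewrite !mxE.
rewrite subr0 rowB.
rewrite (nabla_nabla_cstE u v w k Ux) (nabla_nabla_cstE v u w k Ux).
rewrite (dot_hess_row v u Ux) (dotC v u).
by ring.
Qed.

Lemma dmap_id X : dmap id X = X.
Proof. by apply/funext => x; rewrite /dmap derive_id. Qed.

Lemma pullback_nabla_id X V : pullback_nabla g id X V = nabla g X V.
Proof. by apply/funext => x; rewrite /pullback_nabla dmap_id. Qed.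

Lemma nabla_euclidean_cst u v : nabla euclidean (cst u) (cst v) = cst 0.
Proof. by apply/funext => x; rewrite nabla_euclidean derive_cst. Qed.

(** The source is flat, so only the trace of the Christoffel symbols of [g] remains; direction [i]
    contributes [2 s_i] at [k = i] and [- s_k] for every [k]. *)
Lemma tension_idE x : U x -> tension euclidean g id x = (2 - n%:R) *: row_of x.
Proof.
move=> Ux; rewrite /tension trace_euclidean; apply/rowP => k.
rewrite summxE [RHS]mxE row_ofE.
rewrite (eq_bigr (fun i => 2 * s i x * (i == k)%:R - s k x)).
  by rewrite sumrB sum_delta sum_const_ord; ring.
move=> i _; rewrite /second_fundamental_form pullback_nabla_id !dmap_id.
rewrite nabla_euclidean_cst subr0 nabla_evecE// => [|j];
  last exact: smooth_on_cst.
by rewrite pderiv_cst !dot_evec evec_diag !evecE row_ofE eq_sym; ring.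
Qed.

Lemma smooth_sqnorm : smooth_on U sqnorm.
Proof.
apply: smooth_on_sum => // i; under eq_fun do rewrite row_ofE.
exact: smooth_onM.
Qed.

Lemma pderiv_sqnorm k x : U x ->
  pderiv k sqnorm x = 2 * hess_row (row_of x) x 0 k.
Proof.
move=> Ux; have sdd i := smooth_onM oU (smooth_s i) (smooth_s i).
have -> : sqnorm = fun y => \sum_i s i y * s i y.
  by apply/funext => y; apply: eq_bigr => i _; rewrite row_ofE.
rewrite (pderiv_sum k sdd Ux) mxE mulr_sumr; apply: eq_bigr => i _.
rewrite (pderivM k (smooth_s i) (smooth_s i) Ux) row_ofE (pderiv_s k i Ux).
by rewrite (hC k i Ux); ring.
Qed.

(** The two products [s_i s_k] in the connection term cancel, leaving the Hessian and [|s|^2] along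
    [evec i]. *)
Lemma nabla_evec_rowE (c : R) i x : U x ->
  nabla g (cst (evec i)) (fun y => c *: row_of y) x =
  \row_k (c * (h i k x + sqnorm x * (k == i)%:R)).
Proof.
move=> Ux; apply/rowP => k.
have rE j : (fun y => (c *: row_of y) 0 j) = fun y => c * s j y.
  by apply/funext => y; rewrite mxE row_ofE.
rewrite nabla_evecE// => [|j]; last first.
  by rewrite rE; exact: smooth_onM (smooth_on_cst _) (smooth_s _).
have dZ u v : dot u (c *: v) = c * dot u v.
  by rewrite /dot mulr_sumr; apply: eq_bigr => j _; rewrite mxE; ring.
rewrite rE dZ -/(sqnorm x) (pderivM i (smooth_on_cst c) (smooth_s k) Ux).
rewrite pderiv_cst (pderiv_s i k Ux) !mxE.
by ring.
Qed.

(** The constant [c] will be the factor [2 - n] of the tension field. The coefficient 4 collects 2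
    from the derivative of [sqnorm], 1 from the scalar product of [s] with the inner derivative, and
    1 from [s_i h_ik]. *)
Lemma rough_laplacianE (c : R) k x : U x ->
  (\sum_i nabla g (cst (evec i))
     (nabla g (cst (evec i)) (fun y => c *: row_of y)) x) 0 k =
  c * (\sum_i pderiv i (h i k) x + 4 * hess_row (row_of x) x 0 k
       + (2 - n%:R) * sqnorm x * s k x - hess_trace x * s k x).
Proof.
move=> Ux; rewrite summxE.
have sc (a : R) : smooth_on U (fun=> a) by exact: smooth_on_cst.
pose W i y : 'rV[R]_n := \row_j (c * (h i j y + sqnorm y * (j == i)%:R)).
have WE i j : (fun y => W i y 0 j) =
    fun y => c * (h i j y + sqnorm y * (j == i)%:R).
  by apply/funext => y; rewrite mxE.
have sd i j := smooth_onM oU smooth_sqnorm (sc (j == i)%:R).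
have sW i j := smooth_onD oU (smooth_h i j) (sd i j).
have dW i : dot (row_of x) (W i x) =
    c * (hess_row (row_of x) x 0 i + sqnorm x * s i x).
  rewrite mxE -(sum_delta i (fun j => s j x)) mulr_sumr -big_split mulr_sumr.
  apply: eq_bigr => j _; rewrite row_ofE mxE (hC i j Ux) /=.
  by ring.
rewrite (eq_bigr (fun i => c * (pderiv i (h i k) x + s i x * h i k x +
  (3 * hess_row (row_of x) x 0 i + 2 * sqnorm x * s i x) * (i == k)%:R
  - h i i x * s k x - sqnorm x * s k x))).
  rewrite -mulr_sumr !sumrB !big_split/= sum_delta -mulr_suml.
  rewrite sum_const_ord -/(hess_trace x).
  have -> : \sum_i s i x * h i k x = hess_row (row_of x) x 0 k.
    by rewrite mxE; apply: eq_bigr => i _; rewrite row_ofE.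
  by ring.
move=> i _.
rewrite (@nabla_eq_on _ _ U g _ (cst (evec i)) _ (W i) x oU Ux erefl
  (nabla_evec_rowE c i)).
rewrite nabla_evecE// => [|j]; last first.
  by rewrite WE; exact: smooth_onM (sc _) (sW _ _).
rewrite dW WE (pderivM i (sc c) (sW i k) Ux)
  (pderivD i (smooth_h i k) (sd i k) Ux).
rewrite (pderivM i smooth_sqnorm (sc (k == i)%:R) Ux) !pderiv_cst.
rewrite (pderiv_sqnorm i Ux) [W i x 0 k]mxE [W i x 0 i]mxE eqxx mulr1
  [k == i]eq_sym.
by ring.
Qed.

(** For [g = lambda^2 dx^2] these are the components [Ric(u, e_k)], in the classical form for a
    conformally flat metric. *)
Lemma trace_curvatureE u k x : U x ->
  (\sum_i curvature_at g x u (evec i) (evec i)) 0 k =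
  (2 - n%:R) * hess_row u x 0 k - hess_trace x * u 0 k
  + (n%:R - 2) * dot (row_of x) u * s k x - (n%:R - 2) * sqnorm x * u 0 k.
Proof.
move=> Ux; rewrite summxE.
rewrite (eq_bigr (fun i => (hess_row u x 0 i - dot (row_of x) u * s i x
  + sqnorm x * u 0 i) * (i == k)%:R + u 0 i * h i k x
  - s k x * (u 0 i * s i x) - h i i x * u 0 k + s i x * s i x * u 0 k
  - sqnorm x * u 0 k - hess_row u x 0 k + dot (row_of x) u * s k x)).
  rewrite !(sumrB, big_split)/= sum_delta.
  have -> : \sum_i u 0 i * h i k x = hess_row u x 0 k by rewrite mxE.
  have -> : \sum_i s k x * (u 0 i * s i x) = s k x * dot (row_of x) u.
    by rewrite mulr_sumr; apply: eq_bigr => i _;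
      rewrite row_ofE [s i x * _]mulrC.
  have -> : \sum_i h i i x * u 0 k = hess_trace x * u 0 k by rewrite mulr_suml.
  have -> : \sum_i s i x * s i x * u 0 k = sqnorm x * u 0 k.
    by rewrite mulr_suml; apply: eq_bigr => i _; rewrite row_ofE.
  rewrite !sum_const_ord.
  by ring.
move=> i _; rewrite (curvature_atE _ _ _ k Ux) !dot_evec !hess_row_evec.
by rewrite evec_diag !evecE !row_ofE [k == i]eq_sym; ring.
Qed.

(** For [u] proportional to [s] the two [|s|^2] terms of the curvature trace cancel; what is left
    turns the Hessian coefficient 4 into [6 - n] and doubles the [hess_trace] term. *)
Lemma bitension_idE k x : U x -> bitension euclidean g id x 0 k =
  (n%:R - 2) * (\sum_i pderiv i (h i k) x
    + (6 - n%:R) * hess_row (row_of x) x 0 k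
    - (n%:R - 2) * sqnorm x * s k x - 2 * hess_trace x * s k x).
Proof.
move=> Ux; rewrite /bitension !trace_euclidean.
have rowNB (a b : 'rV[R]_n) : (- a - b) 0 k = - a 0 k - b 0 k by rewrite !mxE.
rewrite rowNB.
have -> : \sum_i curvature_at g (id x) (tension euclidean g id x)
    (dmap id (cst (evec i)) x) (dmap id (cst (evec i)) x) =
    \sum_i curvature_at g x ((2 - n%:R) *: row_of x) (evec i) (evec i).
  by apply: eq_bigr => i _; rewrite dmap_id tension_idE.
have -> : \sum_i pullback_nabla2 euclidean g id (tension euclidean g id)
    (cst (evec i)) (cst (evec i)) x = \sum_i nabla g (cst (evec i))
     (nabla g (cst (evec i)) (fun y => (2 - n%:R) *: row_of y)) x.
  apply: eq_bigr => i _; rewrite /pullback_nabla2 !pullback_nabla_id.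
  rewrite nabla_euclidean_cst.
  (* The correction term of the second covariant derivative vanishes, since coordinate fields are
     parallel for the Euclidean source. *)
  have -> : nabla g (cst 0) (tension euclidean g id) x = 0.
    rewrite /nabla /cst derive0 add0r; apply/rowP => j; rewrite !mxE.
    by rewrite big1// => a _; rewrite big1// => b _; rewrite mxE mulr0 mul0r.
  rewrite subr0; apply: (@nabla_eq_on _ _ U) => // y Uy.
  by apply: (@nabla_eq_on _ _ U) => // z Uz; exact: tension_idE.
rewrite (rough_laplacianE _ k Ux) (trace_curvatureE _ k Ux).
have hZ c u : hess_row (c *: u) x 0 k = c * hess_row u x 0 k.
  by rewrite !mxE mulr_sumr; apply: eq_bigr => i _; rewrite mxE mulrA.
have dZ u v (c : R) : dot u (c *: v) = c * dot u v.
  by rewrite /dot mulr_sumr; apply: eq_bigr => j _; rewrite mxE; ring.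
have rZ (c : R) : (c *: row_of x) 0 k = c * s k x by rewrite mxE row_ofE.
by rewrite hZ dZ -/(sqnorm x) rZ; ring.
Qed.

Lemma trace_ricciE x : U x -> \sum_j ricci g x (evec j) (evec j) =
  - (n%:R - 1) * (2 * hess_trace x + (n%:R - 2) * sqnorm x).
Proof.
move=> Ux.
have trE : \sum_i s i x * s i x = sqnorm x.
  by apply: eq_bigr => i _; rewrite row_ofE.
rewrite (eq_bigr (fun j => 2 * h j j x - 2 * (s j x * s j x) + sqnorm x
   - n%:R * h j j x - hess_trace x + sqnorm x + n%:R * (s j x * s j x)
   - n%:R * sqnorm x)).
  rewrite !(sumrB, big_split)/=.
  have trhE c : \sum_j c * h j j x = c * hess_trace x by rewrite mulr_sumr.
  have trsE c : \sum_j c * (s j x * s j x) = c * sqnorm x.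
    by rewrite -trE mulr_sumr.
  rewrite !trhE !trsE !sum_const_ord.
  by ring.
move=> j _; rewrite /ricci.
rewrite (eq_bigr (fun i => (2 * h i j x - 2 * s i x * s j x + sqnorm x)
   * (i == j)%:R - h j j x - h i i x + s i x * s i x + s j x * s j x
   - sqnorm x)).
  rewrite !(sumrB, big_split)/= sum_delta trE -/(hess_trace x).
  by rewrite !sum_const_ord; ring.
move=> i _; rewrite (curvature_atE _ _ _ i Ux) !dot_evec !hess_row_evec.
rewrite !evec_diag !evecE !row_ofE (hC j i Ux) [j == i]eq_sym.
(* The delta occurs squared, once from a scalar product and once from a component, so [ring] needs
   its idempotence. *)
have dd : (i == j)%:R * (i == j)%:R = (i == j)%:R :> R.
  by rewrite -natrM mulnb andbb.
by ring: dd.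
Qed.

End ConformalConnection.

(** * The metric [lambda^2 dx^2] in arbitrary dimension *)

Section ConformallyFlat.
Context {R : realType} {n : nat}.
Implicit Types (i j k : 'I_n).
Context (U : set 'rV[R]_n) (lambda : 'rV[R]_n -> R).
Context (oU : open U) (slam : smooth_on U lambda)
  (lam_gt0 : forall x, U x -> 0 < lambda x).

Local Notation gt := (conformal lambda euclidean).

(** The gradient of [log lambda], as a product whose smoothness follows from the closure rules. *)
Definition dlog i (x : 'rV[R]_n) : R := (lambda x)^-1 * pderiv i lambda x.

Definition hlog i j : 'rV[R]_n -> R := pderiv i (dlog j).

Lemma lambda_neq0 x : U x -> lambda x != 0.
Proof. by move=> Ux; rewrite lt0r_neq0// lam_gt0. Qed.

Lemma smooth_lambdaV : smooth_on U (fun x => (lambda x)^-1).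
Proof. exact: smooth_onV oU slam lambda_neq0. Qed.

Lemma smooth_dlog i : smooth_on U (dlog i).
Proof. exact: smooth_onM oU smooth_lambdaV (smooth_on_pderiv i slam). Qed.

Lemma smooth_hlog i j : smooth_on U (hlog i j).
Proof. exact/smooth_on_pderiv/smooth_dlog. Qed.

Lemma smooth_hlog_trace : smooth_on U (hess_trace hlog).
Proof. by apply: smooth_on_sum => // i; exact: smooth_hlog. Qed.

Lemma pderiv_lambda i x : U x -> pderiv i lambda x = lambda x * dlog i x.
Proof. by move=> Ux; rewrite /dlog mulrA mulfV ?mul1r// lambda_neq0. Qed.

(** By the quotient rule [hlog] is [lambda^-1] times the Hessian of [lambda] minus a product of
    first derivatives, both symmetric. *)
Lemma hlogC i j x : U x -> hlog i j x = hlog j i x.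
Proof.
have E a b y : U y -> hlog a b y =
    (lambda y)^-1 * pderiv a (pderiv b lambda) y - dlog a y * dlog b y.
  move=> Uy; rewrite /hlog /dlog.
  rewrite (pderivM a smooth_lambdaV (smooth_on_pderiv b slam) Uy).
  by rewrite (pderivV a slam Uy (lambda_neq0 Uy)) /dlog; ring.
move=> Ux; rewrite (E i j x Ux) (E j i x Ux) (pderivC i j oU slam Ux).
by congr (_ - _); exact: mulrC.
Qed.

(** Third derivatives of [log lambda] commute, which turns the divergence of its Hessian into a
    gradient; this is how the bitension field can become a gradient up to a factor. *)
Lemma pderiv_hlog_trace k x : U x ->
  pderiv k (hess_trace hlog) x = \sum_i pderiv i (hlog i k) x.
Proof.
move=> Ux; rewrite /hess_trace (pderiv_sum k (fun i => smooth_hlog i i) Ux).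
apply: eq_bigr => i _; apply: etrans (pderivC k i oU (smooth_dlog i) Ux) _.
exact (eq_on_pderiv i oU (hlogC k i) Ux).
Qed.

Lemma laplacian_lambda x : U x ->
  laplacian euclidean lambda x = lambda x * (hess_trace hlog x + sqnorm dlog x).
Proof.
move=> Ux; rewrite /laplacian /divergence /sqnorm /dot /hess_trace.
rewrite -big_split/= mulr_sumr.
have gE y j : grad euclidean lambda y 0 j = pderiv j lambda y.
  rewrite mxE -[RHS](sum_delta j (fun i => pderiv i lambda y));
    apply: eq_bigr => i _.
  by rewrite ginv_euclidean mulrC eq_sym.
apply: eq_bigr => i _; rewrite row_ofE nabla_euclidean derive_row; last first.
  move=> j; under eq_fun do rewrite gE.
  by apply: smooth_on_differentiable Ux; exact: smooth_on_pderiv.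
under eq_bigr do rewrite evecE mulrC.
rewrite sum_delta; under eq_fun do rewrite gE.
rewrite (eq_on_pderiv i oU (pderiv_lambda i) Ux).
rewrite (pderivM i slam (smooth_dlog i) Ux) (pderiv_lambda i Ux) -/(hlog i i).
by ring.
Qed.

Lemma conformalE x i j : gt x i j = lambda x * lambda x * (i == j)%:R.
Proof. by rewrite /conformal /euclidean !mxE expr2. Qed.

Lemma ginv_conformal x i j : U x ->
  ginv gt x i j = (lambda x)^-1 * (lambda x)^-1 * (i == j)%:R.
Proof.
move=> Ux; rewrite /ginv /conformal /euclidean scalemx1 invmx_scalar mxE.
by rewrite expr2 invfM mulr_natr.
Qed.

Lemma christoffel_conformal k i j x : U x ->
  christoffel gt k i j x =
  (j == k)%:R * dlog i x + (i == k)%:R * dlog j x - (i == j)%:R * dlog k x.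
Proof.
move=> Ux; have l0 := lambda_neq0 Ux.
have dg a b c : pderiv a (fun y => gt y b c) x =
    2 * (lambda x * lambda x) * dlog a x * (b == c)%:R.
  under eq_fun do rewrite conformalE.
  rewrite (pderivM a (smooth_onM oU slam slam) (smooth_on_cst _) Ux).
  by rewrite (pderivM a slam slam Ux) pderiv_cst (pderiv_lambda a Ux); ring.
rewrite /christoffel (eq_bigr (fun l => 2 * ((j == l)%:R * dlog i x +
    (i == l)%:R * dlog j x - (i == j)%:R * dlog l x) * (l == k)%:R)).
  by rewrite sum_delta; field.
by move=> l _; rewrite !dg (ginv_conformal k l Ux) [k == l]eq_sym; field.
Qed.

(** The inverse metric is [lambda^-2] times the identity, so this is the Euclidean trace of the
    Ricci tensor rescaled. *)
Lemma scalar_curvature_conformal x : U x -> scalar_curvature gt x =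
  - (n%:R - 1) * ((lambda x)^-1 * (lambda x)^-1) *
  (2 * hess_trace hlog x + (n%:R - 2) * sqnorm dlog x).
Proof.
move=> Ux; rewrite mulrAC.
rewrite -(trace_ricciE oU smooth_dlog (fun _ _ _ _ => erefl) hlogC
  christoffel_conformal Ux) mulr_suml.
apply: eq_bigr => i _.
rewrite -(sum_delta i (fun j => ricci gt x (evec i) (evec j) *
  ((lambda x)^-1 * (lambda x)^-1))).
by apply: eq_bigr => j _; rewrite (ginv_conformal i j Ux) eq_sym; ring.
Qed.

Lemma bitension_conformal k x : U x -> bitension euclidean gt id x 0 k =
  (n%:R - 2) * (pderiv k (hess_trace hlog) x
    + (6 - n%:R) * hess_row hlog (row_of dlog x) x 0 k
    - (n%:R - 2) * sqnorm dlog x * dlog k x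
    - 2 * hess_trace hlog x * dlog k x).
Proof.
move=> Ux; rewrite (pderiv_hlog_trace k Ux).
exact: (bitension_idE oU smooth_dlog smooth_hlog (fun _ _ _ _ => erefl) hlogC
  christoffel_conformal k Ux).
Qed.

(* Equal to [lambda^-3 * Delta lambda]. *)
Definition yamabe_quotient (x : 'rV[R]_n) : R :=
  (lambda x)^-1 * (lambda x)^-1 * (hess_trace hlog x + sqnorm dlog x).

Lemma smooth_sqnorm_dlog : smooth_on U (sqnorm dlog).
Proof. exact (smooth_sqnorm oU smooth_dlog). Qed.

Lemma smooth_yamabe_quotient : smooth_on U yamabe_quotient.
Proof.
apply: smooth_onM oU (smooth_onM oU smooth_lambdaV smooth_lambdaV) _.
exact: smooth_onD oU smooth_hlog_trace smooth_sqnorm_dlog.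
Qed.

Lemma pderiv_yamabe_quotient k x : U x -> pderiv k yamabe_quotient x =
  (lambda x)^-1 * (lambda x)^-1 * (pderiv k (hess_trace hlog) x
    + 2 * hess_row hlog (row_of dlog x) x 0 k
    - 2 * dlog k x * (hess_trace hlog x + sqnorm dlog x)).
Proof.
move=> Ux; have sV := smooth_lambdaV; have l0 := lambda_neq0 Ux.
have sT := smooth_hlog_trace; have sN := smooth_sqnorm_dlog.
rewrite /yamabe_quotient (pderivM k (smooth_onM oU sV sV)
  (smooth_onD oU sT sN) Ux).
rewrite (pderivM k sV sV Ux) (pderivV k slam Ux l0) (pderivD k sT sN Ux).
rewrite (pderiv_sqnorm oU smooth_dlog (fun _ _ _ _ => erefl) hlogC k Ux).
rewrite (pderiv_lambda k Ux).
(* With the geometric quantities generalized to scalars, a rational identity in [lambda x]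
   remains. *)
move: (hess_trace _ _) (sqnorm _ _) (pderiv _ _ _) (hess_row _ _ _ _ _).
move: (dlog k x) => d t N T r.
by field.
Qed.

End ConformallyFlat.

Lemma locally_constant_on_comp {R : realType} {n : nat} (U : set 'rV[R]_n)
  (F : R -> R) (f g : 'rV[R]_n -> R) : open U ->
  (forall x, U x -> g x = F (f x)) ->
  locally_constant_on U f -> locally_constant_on U g.
Proof.
move=> oU gE fc x Ux; apply: filterS2 (fc x Ux) (open_nbhs_nbhs (conj oU Ux)).
by move=> y fy Uy; rewrite !gE// fy.
Qed.

Lemma scalar_curvature_euclidean {R : realType} {n : nat} (x : 'rV[R]_n) :
  scalar_curvature euclidean x = 0.
Proof.
rewrite /scalar_curvature big1// => i _; rewrite big1// => j _.
rewrite /ricci big1 ?mulr0// => k _; rewrite /curvature_at /curvature.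
rewrite !nabla_euclidean !nabla_euclidean_cst /lie_bracket !derive_cst.
by rewrite !subrr mxE.
Qed.

(** * Dimension 4: all conditions expressed through [q] *)

Section DimensionFour.
Context {R : realType} (U : set 'rV[R]_4) (lambda : 'rV[R]_4 -> R).
Context (oU : open U) (slam : smooth_on U lambda)
  (lam_gt0 : forall x, U x -> 0 < lambda x).

Local Notation q := (yamabe_quotient lambda).

Lemma laplacian_yamabe_quotient x : U x ->
  laplacian euclidean lambda x = lambda x ^+ 3 * q x.
Proof.
move=> Ux; have l0 := lambda_neq0 lam_gt0 Ux.
rewrite (laplacian_lambda oU slam lam_gt0 Ux) /yamabe_quotient.
move: (hess_trace _ _) (sqnorm _ _) => t N.
by field.
Qed.

(** For [n = 4] the factor [n - 2] is 2, so trace and norm have equal weight as in [q]; the constant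
    is [- 3 * 2]. *)
Lemma scalar_curvature_yamabe_quotient x : U x ->
  scalar_curvature (conformal lambda euclidean) x = - 6 * q x.
Proof.
move=> Ux; rewrite (scalar_curvature_conformal oU slam lam_gt0 Ux)
  /yamabe_quotient.
move: (hess_trace _ _) (sqnorm _ _) => t N.
by ring.
Qed.

Lemma biharmonic_yamabe_quotient :
  biharmonic_metric U euclidean (conformal lambda euclidean) <->
  locally_constant_on U q.
Proof.
(* Here [6 - n] and [n - 2] are both 2, exactly the coefficients produced by differentiating [q]. *)
have E k x : U x -> bitension euclidean (conformal lambda euclidean) id x 0 k =
    2 * (lambda x * lambda x) * pderiv k q x.
  move=> Ux; have l0 := lambda_neq0 lam_gt0 Ux.
  rewrite (bitension_conformal oU slam lam_gt0 k Ux).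
  rewrite (pderiv_yamabe_quotient oU slam lam_gt0 k Ux).
  move: (hess_trace _ _) (sqnorm _ _) (pderiv _ _ _) (hess_row _ _ _ _ _).
  move: (dlog _ k x) => d t N T r.
  by field.
split=> [bh|qc x Ux].
  apply: pderiv0_locally_constant oU (smooth_yamabe_quotient oU slam lam_gt0) _.
  move=> k x Ux; have l0 := lambda_neq0 lam_gt0 Ux.
  apply: (mulfI (_ : 2 * (lambda x * lambda x) != 0)).
    by rewrite !mulf_neq0// pnatr_eq0.
  by rewrite -(E k x Ux) (bh x Ux) mxE mulr0.
apply/rowP => k.
by rewrite (E k x Ux) (locally_constant_pderiv k qc Ux) mxE mulr0.
Qed.

(** For [n = 4] the Laplacian has coefficient -6, the exponent is 3 and the background is
    scalar-flat; dividing by [lambda^3] leaves the condition on [q]. *)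
Lemma yamabe_eqE (S : 'rV[R]_4 -> R) :
  yamabe_eq U euclidean S lambda <-> forall x, U x -> S x = - 6 * q x.
Proof.
have E x : U x -> - (4 * (4%:R - 1) / (4%:R - 2)) * laplacian euclidean lambda x
    + scalar_curvature euclidean x * lambda x = (- 6 * q x) * lambda x ^+ 3.
  move=> Ux; rewrite scalar_curvature_euclidean (laplacian_yamabe_quotient Ux).
  by move: (q x) => r; field.
(* Positivity of [lambda] allows the real power to be read as an integer power. *)
have P x : U x -> lambda x `^ ((4%:R + 2) / (4%:R - 2)) = lambda x ^+ 3.
  move=> Ux; rewrite -powR_mulrn ?ltW ?lam_gt0//; congr (_ `^ _).
  by field.
split=> H x Ux; have l0 := lambda_neq0 lam_gt0 Ux.
  have := H x Ux; rewrite (E x Ux) (P x Ux) => /mulIf -> //.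
  exact: expf_neq0.
by rewrite (E x Ux) (P x Ux) (H x Ux).
Qed.

Lemma laplacian_scalar_curvatureE (S : 'rV[R]_4 -> R) :
  ((forall x, U x -> scalar_curvature (conformal lambda euclidean) x = S x) /\
   (forall x, U x ->
      laplacian euclidean lambda x = - (S x / 6) * lambda x ^+ 3))
  <-> forall x, U x -> S x = - 6 * q x.
Proof.
split=> [[H _] x Ux|H];
  first by rewrite -(H x Ux) scalar_curvature_yamabe_quotient.
split=> x Ux; rewrite (H x Ux); first exact: scalar_curvature_yamabe_quotient.
by rewrite (laplacian_yamabe_quotient Ux); move: (q x) => r; field.
Qed.

(** The equation [S = - 6 q] is the common form of the Yamabe and the scalar curvature conditions;
    local constancy passes between [S] and [q] by scaling. *)
Lemma biharmonic_iff_locally_constant :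
  biharmonic_metric U euclidean (conformal lambda euclidean) <->
  exists S, locally_constant_on U S /\ forall x, U x -> S x = - 6 * q x.
Proof.
rewrite biharmonic_yamabe_quotient; split=> [qc|[S [Sc SE]]].
  exists (fun x => - 6 * q x); split=> //.
  exact: (@locally_constant_on_comp _ _ U (fun r => - 6 * r) q).
apply: (@locally_constant_on_comp _ _ U (fun r => - r / 6) S) => // x Ux.
by rewrite (SE x Ux); move: (q x) => r; field.
Qed.

Lemma biharmonic_iff_constant : connected U ->
  biharmonic_metric U euclidean (conformal lambda euclidean) <->
  exists c, forall x, U x -> c = - 6 * q x.
Proof.
move=> cU; rewrite biharmonic_iff_locally_constant;
  split=> [[S [Sc SE]]|[c cE]].
  have [c cS] := locally_constant_connected oU cU Sc.
  by exists c => x Ux; rewrite -(cS x Ux) SE.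
by exists (fun=> c); split=> // x _; apply: filterE.
Qed.

End DimensionFour.

(* "R constant" on a disconnected open set means constant on each connected
   component, i.e. locally constant: the first conjunct is for U connected, the
   second for arbitrary open U. *)
Theorem corollary3p3 (R : realType) (U : set 'rV[R]_4) (lambda : 'rV[R]_4 -> R)
  (hU : open U) (hsmooth : smooth_on U lambda)
  (hpos : forall x, U x -> 0 < lambda x) :
  let dx2 : metric R 4 := euclidean in
  let gt : metric R 4 := conformal lambda dx2 in
  (connected U ->
     (biharmonic_metric U dx2 gt <-> yamabe_solution U dx2 lambda) /\
     (biharmonic_metric U dx2 gt <->
        exists c : R,
          (forall x, U x -> scalar_curvature gt x = c) /\
          (forall x, U x ->
             laplacian dx2 lambda x = - (c / 6) * lambda x ^+ 3))) /\
  ((biharmonic_metric U dx2 gt <->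
      exists S : 'rV[R]_4 -> R,
        locally_constant_on U S /\ yamabe_eq U dx2 S lambda) /\
   (biharmonic_metric U dx2 gt <->
      exists S : 'rV[R]_4 -> R,
        locally_constant_on U S /\
        (forall x, U x -> scalar_curvature gt x = S x) /\
        (forall x, U x ->
           laplacian dx2 lambda x = - (S x / 6) * lambda x ^+ 3))).
Proof.
move=> dx2 gt; split=> [cU|]; split.
- rewrite (biharmonic_iff_constant hU hsmooth hpos cU).
  by split=> -[c cE]; exists c; exact/(yamabe_eqE hU hsmooth hpos).
- rewrite (biharmonic_iff_constant hU hsmooth hpos cU).
  by split=> -[c cE]; exists c;
    exact/(laplacian_scalar_curvatureE hU hsmooth hpos (fun=> c)).
- rewrite (biharmonic_iff_locally_constant hU hsmooth hpos).
  by split=> -[S [Sc SE]]; exists S; split=> //;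
    exact/(yamabe_eqE hU hsmooth hpos).
- rewrite (biharmonic_iff_locally_constant hU hsmooth hpos).
  by split=> -[S [Sc SE]]; exists S; split=> //;
    exact/(laplacian_scalar_curvatureE hU hsmooth hpos).
Qed.
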